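(* Let $A$ be a regular system of divisors and $n\in\mathbb N$. Then \[ \prod_{\substack{j=1\\ (j,n)_A=1}}^n\left(x^{(j-1,n)_A}-1\right)=\prod_{d\in A(n)}\Phi_{A,d}(x)^{\varphi_A(n)/\varphi_A(d)}. \]
   Context: A regular system of divisors is a family $A=(A(n))_{n\in\mathbb N}$, where each $A(n)$ is a set of positive divisors of $n$, such that: (i) $A(1)=\{1\}$ and $A(mn)=\{de: d\in A(m), e\in A(n)\}$ whenever $\gcd(m,n)=1$; (ii) for every prime power $p^a$ ($a\ge1$) there is a divisor $t=t_A(p^a)$ of $a$ such that $A(p^{it})=\{1,p^t,\dots,p^{it}\}$ for every $0\le i\le a/t$. For $j\in\mathbb Z$ (including $j=0$), $(j,n)_A=\max\{d\in\mathbb N: d\mid j,\ d\in A(n)\}$; $\zeta_n=e^{2\pi i/n}$; $\Phi_{A,n}(x)=\prod_{1\le j\le n,\ (j,n)_A=1}(x-\zeta_n^j)$; $\varphi_A(n)=\#\{1\le j\le n:(j,n)_A=1\}$. *)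

(* Defs.v *)
From HB Require Import structures.
From mathcomp Require Export all_boot all_order all_algebra.
From mathcomp Require Export finmap.
From mathcomp Require Export reals trigo.
From mathcomp.real_closed Require Export complex.

Set Implicit Arguments.
Unset Strict Implicit.
Unset Printing Implicit Defensive.

Import Order.TTheory GRing.Theory Num.Theory.

Local Open Scope fset_scope.
Local Open Scope nat_scope.

(* The family is indexed by the positive integers: [A 0] is left
   unconstrained. In the last field [t] is automatically positive, since it
   divides [a > 0]. *)
Record regular_system (A : nat -> {fset nat}) : Prop := RegularSystem {
  regular_system_dvd : forall n d, 0 < n -> d \in A n -> d %| n;
  regular_system1 : A 1 = [fset 1];
  regular_systemM : forall m n, 0 < m -> 0 < n -> coprime m n ->
    A (m * n) = [fset d * e | d in A m, e in A n];
  regular_systemX : forall p a, prime p -> 0 < a ->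
    exists2 t, t %| a &
      forall i, i <= a %/ t ->
        A (p ^ (i * t)) = [fset p ^ (k * t) | k in iota 0 i.+1]
}.

Definition gcdA (A : nat -> {fset nat}) (j : int) (n : nat) : nat :=
  \max_(d <- A n | (d%:Z %| j)%Z) d.

Definition totientA (A : nat -> {fset nat}) (n : nat) : nat :=
  \sum_(1 <= j < n.+1 | gcdA A j n == 1) 1.

Local Open Scope ring_scope.

(* exp (2 pi i / n), in Cartesian form. *)
Definition zeta (R : realType) (n : nat) : R[i] :=
  Complex (cos (2 * pi / n%:R)) (sin (2 * pi / n%:R)).

Definition PhiA (R : realType) (A : nat -> {fset nat}) (n : nat)
    : {poly R[i]} :=
  \prod_(1 <= j < n.+1 | gcdA A j n == 1%N) ('X - (zeta R n ^+ j)%:P).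

(* Main.v *)
(* Locally [A d], for [d] in [A n], consists of the divisors of [d] whose
   exponent at every prime [p] is a multiple of a fixed step [t p]. Hence
   [gcdA] is a greatest common divisor for divisibility, and sorting the
   [m]-th roots of unity by [gcdA] gives
   [X^m - 1 = \prod_(d in A m) PhiA d]. Substituting this in the left-hand
   side and exchanging the products, [PhiA d] gets as exponent the number of
   [j] prime to [n] (for [gcdA]) with [j = 1] modulo [d]. The residues [j]
   prime to [n] are equidistributed among the classes modulo [d] prime to
   [d], so this number is [totientA n / totientA d]. *)
From mathcomp Require Import ring lra.
Require Import Defs.

Set Implicit Arguments.
Unset Strict Implicit.
Unset Printing Implicit Defensive.

Import Order.TTheory GRing.Theory Num.Theory.

Local Open Scope fset_scope.
Local Open Scope nat_scope.

(** * Local description of a regular system by prime exponents *)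

Definition stepped (t : nat -> nat) (d : nat) : Prop :=
  forall p, prime p -> t p %| logn p d.

Lemma logn_mul_pfactor p q m b : prime p -> 0 < m -> coprime p m ->
  logn q (m * p ^ b) = if q == p then b else logn q m.
Proof.
move=> p_pr m_gt0 co_pm; have pb_gt0 : 0 < p ^ b by rewrite expn_gt0 prime_gt0.
rewrite lognM // lognX.
case: eqVneq => [->|neq_qp].
  by rewrite logn_coprime // logn_prime // eqxx muln1.
by rewrite (logn_prime _ p_pr) (negbTE neq_qp) muln0 addn0.
Qed.

Lemma stepped_mul_pfactor t p s m b : prime p -> 0 < m -> coprime p m ->
  stepped (fun q => if q == p then s else t q) (m * p ^ b) <->
  stepped t m /\ s %| b.
Proof.
move=> p_pr m_gt0 co_pm; split => [st_mb|[st_m dv_sb] q q_pr].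
  split=> [q q_pr|]; last first.
    by have := st_mb _ p_pr; rewrite logn_mul_pfactor // !eqxx.
  have := st_mb _ q_pr; rewrite logn_mul_pfactor //.
  by case: eqVneq => // -> _; rewrite logn_coprime.
by rewrite logn_mul_pfactor //; case: eqVneq => // _; apply: st_m.
Qed.

Lemma dvdn_mul_pfactor p m b m' b' : prime p -> 0 < m' ->
  coprime p m -> coprime p m' ->
  (m * p ^ b %| m' * p ^ b') = (m %| m') && (b <= b').
Proof.
move=> p_pr m'_gt0 co_pm co_pm'; rewrite Gauss_dvd; last first.
  by rewrite coprime_sym coprimeXl.
rewrite Gauss_dvdl; last by rewrite coprime_sym coprimeXl.
by rewrite Gauss_dvdr ?coprimeXl // dvdn_Pexp2l ?prime_gt1.
Qed.

(** Split off the full power of the least prime of [n]: the prime power axiom describes the split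
    part, induction the cofactor, and multiplicativity glues them. The same [t] serves every stepped
    divisor [d] of [n], which allows different sets [A d] to be compared. *)
Lemma regular_system_steps A n : regular_system A -> 0 < n ->
  exists t, [/\ forall p, 0 < t p, stepped t n &
    forall d, d %| n -> stepped t d ->
      forall e, e \in A d <-> e %| d /\ stepped t e].
Proof.
move=> hA; elim/ltn_ind: n => n IHn n_gt0.
have [n_le1|n_gt1] := leqP n 1.
  have -> : n = 1 by apply/eqP; rewrite eqn_leq n_le1.
  exists (fun=> 1); split=> // d.
  rewrite dvdn1 => /eqP -> _ e; rewrite (regular_system1 hA) inE dvdn1.
  by split=> [->|[]] //; split=> // p _; rewrite dvd1n.
set p := pdiv n; have p_pr : prime p by apply: pdiv_prime.
have a_gt0 : 0 < logn p n by rewrite logn_gt0 mem_primes p_pr n_gt0 pdiv_dvd.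
have [m co_pm defn] := pfactor_coprime p_pr n_gt0.
set a := logn p n in a_gt0 defn.
have m_gt0 : 0 < m by move: n_gt0; rewrite defn muln_gt0 => /andP[].
have [t [t_gt0 st_m tP]] : exists t, [/\ forall p, 0 < t p, stepped t m &
    forall d, d %| m -> stepped t d ->
      forall e, e \in A d <-> e %| d /\ stepped t e].
  apply: IHn => //; rewrite defn ltn_Pmulr //.
  by rewrite -(exp1n a) ltn_exp2r // prime_gt1.
have [s dv_sa sP] := regular_systemX hA p_pr a_gt0.
have s_gt0 : 0 < s by rewrite (dvdn_gt0 a_gt0).
(* The cofactor [m] is prime to [p], so the value at [p] of the inductive [t] can be overwritten by
   the step [s] of [p ^ a]. *)
exists (fun q => if q == p then s else t q); split=> [q||d dv_dn st_d e].
- by case: eqP.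
- by rewrite defn; apply/stepped_mul_pfactor.
have d_gt0 : 0 < d by apply: dvdn_gt0 dv_dn.
have [d' co_pd' defd] := pfactor_coprime p_pr d_gt0.
set b := logn p d in defd.
have d'_gt0 : 0 < d' by move: d_gt0; rewrite defd muln_gt0 => /andP[].
move: dv_dn; rewrite defn defd dvdn_mul_pfactor // => /andP[dv_d'm le_ba].
move: st_d; rewrite defd stepped_mul_pfactor // => -[st_d' /dvdnP[i def_b]].
(* Here [b = i * s] with [b <= a], hence [i <= a %/ s], the range in which the axiom applies. *)
have Apb : A (p ^ b) = [fset p ^ (k * s) | k in iota 0 i.+1].
  by rewrite def_b sP // leq_divRL // -def_b.
have co_d'pb : coprime d' (p ^ b) by rewrite coprime_sym coprimeXl.
have pb_gt0 : 0 < p ^ b by rewrite expn_gt0 prime_gt0.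
rewrite (regular_systemM hA) //.
split=> [/imfset2P[x /= Ax [y Ay ->]]|[dv_ed st_e]].
  have [dv_xd' st_x] := (tP _ dv_d'm st_d' x).1 Ax.
  move: Ay; rewrite Apb => /imfsetP[k].
  rewrite [in_mem _ _]mem_iota ltnS => /andP[_ le_ki] ->.
  have co_px : coprime p x by apply: coprime_dvdr co_pd'.
  split; last first.
    apply/stepped_mul_pfactor => //; first exact: dvdn_gt0 dv_xd'.
    by split=> //; apply: dvdn_mull.
  by rewrite dvdn_mul_pfactor // dv_xd' def_b leq_mul2r le_ki orbT.
have e_gt0 : 0 < e by apply: dvdn_gt0 dv_ed; rewrite -defd.
have [e' co_pe' defe] := pfactor_coprime p_pr e_gt0.
set c := logn p e in defe.
have e'_gt0 : 0 < e' by move: e_gt0; rewrite defe muln_gt0 => /andP[].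
move: dv_ed; rewrite defe dvdn_mul_pfactor // => /andP[dv_ed' le_cb].
move: st_e; rewrite defe stepped_mul_pfactor // => -[st_e' /dvdnP[k def_c]].
apply/imfset2P; exists e'; first by rewrite /=; apply/tP.
exists (p ^ c) => //=; rewrite Apb; apply/imfsetP; exists k; last first.
  by rewrite def_c.
by rewrite [in_mem _ _]mem_iota add0n ltnS /= -(leq_pmul2r s_gt0) -def_c -def_b.
Qed.

(** * Closure properties of the sets [A n] *)

Lemma regular_system_gt0 A n d : regular_system A -> 0 < n -> d \in A n ->
  0 < d.
Proof. by move=> hA n_gt0 /(regular_system_dvd hA n_gt0)/(dvdn_gt0 n_gt0). Qed.

Lemma regular_system_self A n : regular_system A -> 0 < n -> n \in A n.
Proof.
move=> hA n_gt0; have [t [t_gt0 st_n tP]] := regular_system_steps hA n_gt0.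
exact/tP.
Qed.

Lemma regular_system_id A n : regular_system A -> 0 < n -> 1 \in A n.
Proof.
move=> hA n_gt0; have [t [t_gt0 st_n tP]] := regular_system_steps hA n_gt0.
by apply/tP => //; split=> [|p _]; rewrite ?dvd1n ?logn1 ?dvdn0.
Qed.

Lemma regular_system_lcm A n d e : regular_system A -> 0 < n ->
  d \in A n -> e \in A n -> lcmn d e \in A n.
Proof.
move=> hA n_gt0 Ad Ae.
have [t [t_gt0 st_n tP]] := regular_system_steps hA n_gt0.
have [[dv_dn st_d] [dv_en st_e]] :
    (d %| n /\ stepped t d) /\ (e %| n /\ stepped t e) by split; apply/tP.
apply/tP => //; split=> [|p p_pr]; first by rewrite dvdn_lcm dv_dn.
rewrite logn_lcm ?(regular_system_gt0 hA n_gt0) //.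
by case: leqP => _; [apply: st_e|apply: st_d].
Qed.

Lemma regular_system_sub A n d e : regular_system A -> 0 < n -> d \in A n ->
  (e \in A d) = (e \in A n) && (e %| d).
Proof.
move=> hA n_gt0 Ad.
have [t [t_gt0 st_n tP]] := regular_system_steps hA n_gt0.
have [dv_dn st_d] := (tP n (dvdnn n) st_n d).1 Ad.
apply/idP/andP => [/tP[] // dv_ed st_e|[/tP[] // dv_en st_e dv_ed]].
  by split=> //; apply/tP => //; split=> //; apply: dvdn_trans dv_dn.
exact/tP.
Qed.

Lemma regular_system_divn A n g : regular_system A -> 0 < n -> g \in A n ->
  n %/ g \in A n.
Proof.
move=> hA n_gt0 Ag.
have [t [t_gt0 st_n tP]] := regular_system_steps hA n_gt0.
have [dv_gn st_g] := (tP n (dvdnn n) st_n g).1 Ag.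
apply/tP => //; split=> [|p p_pr]; first by rewrite -{2}(divnK dv_gn) dvdn_mulr.
by rewrite logn_div // dvdn_sub ?st_n ?st_g.
Qed.

(** The exponents of [g] are multiples of the steps, so adding them to those of [e] does not affect
    steppedness. *)
Lemma regular_system_quo A n g e : regular_system A -> 0 < n -> g \in A n ->
  (e \in A (n %/ g)) = (g * e \in A n).
Proof.
move=> hA n_gt0 Ag.
have [t [t_gt0 st_n tP]] := regular_system_steps hA n_gt0.
have [dv_gn st_g] := (tP n (dvdnn n) st_n g).1 Ag.
have g_gt0 : 0 < g := dvdn_gt0 n_gt0 dv_gn.
have defn : g * (n %/ g) = n by rewrite mulnC divnK.
have ng_gt0 : 0 < n %/ g by rewrite divn_gt0 // dvdn_leq.
have Ang := regular_system_divn hA n_gt0 Ag.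
have [dv_ng st_ng] := (tP n (dvdnn n) st_n _).1 Ang.
have dvE : (g * e %| n) = (e %| n %/ g) by rewrite -{1}defn dvdn_pmul2l.
have stE : 0 < e -> stepped t e <-> stepped t (g * e).
  move=> e_gt0; split=> st p p_pr; have := st p p_pr;
    by rewrite lognM // dvdn_addr // st_g.
apply/idP/idP => [/tP[] // dv_e st_e|/tP[] // dv_e st_e].
  by apply/tP => //; rewrite dvE; split=> //; apply/stE/st_e/(dvdn_gt0 ng_gt0).
rewrite dvE in dv_e.
by apply/tP => //; split=> //; apply/stE/st_e/(dvdn_gt0 ng_gt0).
Qed.

(** * [gcdA] as a greatest common divisor for divisibility *)

Lemma biglcm_regular_system A n (P : pred nat) :
  regular_system A -> 0 < n -> \big[lcmn/1]_(d <- A n | P d) d \in A n.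
Proof.
move=> hA n_gt0; rewrite big_seq_cond.
apply: (big_ind (fun d => d \in A n)); first exact: regular_system_id.
  by move=> d e; apply: regular_system_lcm.
by move=> d /andP[].
Qed.

Lemma biglcm_dvdz (s : seq nat) (j : int) :
  (Posz (\big[lcmn/1]_(d <- s | (d%:Z %| j)%Z) d)%N %| j)%Z.
Proof.
apply: (big_ind (fun d => (d%:Z %| j)%Z)) => // d e.
by rewrite !dvdzE /= dvdn_lcm => -> ->.
Qed.

(* Since [A n] is closed under lcm, the maximum defining [gcdA] is also the
   largest element for divisibility. *)
Lemma gcdA_lcm A j n : regular_system A -> 0 < n ->
  gcdA A j n = \big[lcmn/1]_(d <- A n | (d%:Z %| j)%Z) d.
Proof.
move=> hA n_gt0; apply/eqP; rewrite eqn_leq.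
rewrite leq_bigmax_seq ?biglcm_dvdz ?biglcm_regular_system // andbT.
apply/bigmax_leqP_seq => d Ad dv_dj; apply: dvdn_leq.
  by rewrite (regular_system_gt0 hA n_gt0) ?biglcm_regular_system.
by rewrite (big_rem d) //= dv_dj dvdn_lcml.
Qed.

Lemma gcdA_mem A j n : regular_system A -> 0 < n -> gcdA A j n \in A n.
Proof. by move=> hA n_gt0; rewrite gcdA_lcm // biglcm_regular_system. Qed.

Lemma dvdn_gcdA A j n d : regular_system A -> 0 < n -> d \in A n ->
  (d %| gcdA A j n) = (d%:Z %| j)%Z.
Proof.
move=> hA n_gt0 Ad; rewrite gcdA_lcm //; apply/idP/idP => [dv_d|dv_dj].
  exact: dvdz_trans (biglcm_dvdz (A n) j).
by rewrite (big_rem d) //= dv_dj dvdn_lcml.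
Qed.

(** Members of [A n] divide [n], so they divide both or neither of two integers congruent modulo
    [n]. *)
Lemma gcdA_modz A (i j : int) n : regular_system A -> 0 < n ->
  (i = j %[mod n])%Z -> gcdA A i n = gcdA A j n.
Proof.
move=> hA n_gt0 /eqP; rewrite eqz_mod_dvd => dv_nij.
rewrite /gcdA big_seq_cond [RHS]big_seq_cond; apply: eq_bigl => d.
apply: andb_id2l => Ad.
have dv_dij : (d%:Z %| (i - j)%R)%Z.
  by apply: dvdz_trans dv_nij; rewrite dvdzE; apply: regular_system_dvd Ad.
by rewrite -[i in LHS](subrK j) rpredDl.
Qed.

Lemma gcdA_modn A j n : regular_system A -> 0 < n ->
  gcdA A (j %% n)%N n = gcdA A j n.
Proof. by move=> hA n_gt0; apply: gcdA_modz; rewrite // -modz_nat modz_mod. Qed.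

Lemma gcdA_eq1P A j n : regular_system A -> 0 < n ->
  reflect (forall d, d \in A n -> d %| j -> d = 1) (gcdA A j n == 1).
Proof.
move=> hA n_gt0; apply: (iffP eqP) => [gcd1 d Ad dv_dj|all1].
  by apply/eqP; rewrite -dvdn1 -gcd1 dvdn_gcdA.
have Ag := gcdA_mem j hA n_gt0; apply: all1 => //.
by have := dvdnn (gcdA A j n); rewrite dvdn_gcdA.
Qed.

(** The powers [p ^ t p], for [p] dividing [d], lie in [A d], and each member of [A d] other than 1
    is a multiple of one of them. A single [t] for all [d] in [A n] lets the conditions modulo [n]
    and modulo [d] be compared prime by prime. *)
Lemma gcdA_eq1_steps A n : regular_system A -> 0 < n ->
  exists t, [/\ forall p, 0 < t p,
    forall d, d \in A n -> stepped t d &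
    forall d (j : nat), d \in A n ->
      (gcdA A j d == 1 <->
       forall p, prime p -> p %| d -> ~~ (p ^ t p %| j))].
Proof.
move=> hA n_gt0; have [t [t_gt0 st_n tP]] := regular_system_steps hA n_gt0.
exists t; split=> // [d /tP[]//|d j /[dup] Ad /tP[] // dv_dn st_d].
have d_gt0 : 0 < d := dvdn_gt0 n_gt0 dv_dn.
split=> [/(gcdA_eq1P _ hA d_gt0) all1 p p_pr dv_pd|ndv].
  apply/negP => dv_ptj.
  have /eqP : p ^ t p = 1; last first.
    by rewrite -(expn0 p) eqn_exp2l ?prime_gt1 // eqn0Ngt t_gt0.
  apply: all1 => //; apply/tP => //; split=> [|q q_pr].
    rewrite pfactor_dvdn // dvdn_leq ?st_d //.
    by rewrite logn_gt0 mem_primes p_pr d_gt0.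
  by rewrite lognX logn_prime //; case: eqP => [->|]; rewrite ?muln1 // muln0.
apply/(gcdA_eq1P _ hA d_gt0) => e Ae dv_ej.
apply/eqP; rewrite eqn_leq (regular_system_gt0 hA d_gt0) // andbT leqNgt.
apply/negP => e_gt1; have p_pr := pdiv_prime e_gt1.
have [dv_ed st_e] := (tP d dv_dn st_d e).1 Ae.
have dv_pe := pdiv_dvd e.
have /negP[] := ndv _ p_pr (dvdn_trans dv_pe dv_ed).
apply: dvdn_trans dv_ej; rewrite pfactor_dvdn ?(ltnW e_gt1) //.
by rewrite dvdn_leq ?st_e // logn_gt0 mem_primes p_pr (ltnW e_gt1).
Qed.

(** * Counting residues prime to [n] in classes modulo [d] *)

Lemma big_nat1_periodic (T : Type) (idx : T) (op : Monoid.com_law idx) n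
    (P : pred nat) (F : nat -> T) :
  0 < n -> P n = P 0 -> F n = F 0 ->
  \big[op/idx]_(1 <= j < n.+1 | P j) F j = \big[op/idx]_(j < n | P j) F j.
Proof.
move=> n_gt0 Pn Fn; rewrite -(big_mkord P) big_mkcond [RHS]big_mkcond.
by rewrite big_nat_recr // [RHS]big_ltn //= Pn Fn Monoid.mulmC.
Qed.

Lemma totientA_ord A n : regular_system A -> 0 < n ->
  totientA A n = \sum_(j < n | gcdA A j n == 1) 1.
Proof.
move=> hA n_gt0; rewrite /totientA.
rewrite (@big_nat1_periodic _ _ _ n (fun j => gcdA A j n == 1)) //.
by rewrite -(gcdA_modn n) // modnn.
Qed.

Lemma totientA_gt0 A n : regular_system A -> 0 < n -> 0 < totientA A n.
Proof.
move=> hA n_gt0; rewrite /totientA big_ltn_cond //.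
suff -> : gcdA A 1%N n == 1 by [].
by apply/gcdA_eq1P => // d _; rewrite dvdn1 => /eqP.
Qed.

(* The translation by [c] with [c = v - u] modulo [d] and [c = 0] modulo the
   largest divisor of [n] coprime to [d] permutes the residues modulo [n] and
   preserves the condition [gcdA A j n = 1]: at the primes dividing [d] this
   condition only depends on [j] modulo [d]. *)
Lemma sum_gcdA_eq1_mod A n d u v : regular_system A -> 0 < n -> d \in A n ->
  gcdA A u%:Z d == 1 -> gcdA A v%:Z d == 1 ->
  \sum_(j < n | (gcdA A j n == 1) && (j == u %[mod d])) 1 =
  \sum_(j < n | (gcdA A j n == 1) && (j == v %[mod d])) 1.
Proof.
move=> hA n_gt0 Ad cop_u cop_v.
have An := regular_system_self hA n_gt0.
have d_gt0 := regular_system_gt0 hA n_gt0 Ad.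
have dv_dn := regular_system_dvd hA n_gt0 Ad.
have [t [t_gt0 st tP]] := gcdA_eq1_steps hA n_gt0.
set n' := n`_(\pi(d)^').
have co_dn' : coprime d n'.
  by apply: (@pnat_coprime \pi(d)); rewrite ?pnat_pi ?part_pnat.
have dv_pt p : prime p -> p %| n -> p ^ t p %| n.
  move=> p_pr dv_pn; rewrite pfactor_dvdn // dvdn_leq ?st //.
  by rewrite logn_gt0 mem_primes p_pr n_gt0.
have dv_ptd p : prime p -> p %| d -> p ^ t p %| d.
  move=> p_pr dv_pd; rewrite pfactor_dvdn // dvdn_leq ?st //.
  by rewrite logn_gt0 mem_primes p_pr d_gt0.
have dv_ptn' p : prime p -> p %| n -> ~~ (p %| d) -> p ^ t p %| n'.
  move=> p_pr dv_pn ndv_pd; have := dv_pt p p_pr dv_pn.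
  rewrite -{1}(partnC \pi(d) n_gt0) Gauss_dvdr // coprimeXl //.
  rewrite prime_coprime //; apply: contra ndv_pd => dv_p.
  have := part_pnat \pi(d) n; move/pnatP => /(_ (part_gt0 _ _) p p_pr dv_p).
  by rewrite mem_primes => /and3P[].
(* For [i] congruent modulo [d] to some [w] prime to [d], the conditions at the primes of [d] hold
   automatically; only the other primes of [n] matter. *)
have copE w i : gcdA A w%:Z d == 1 -> i == w %[mod d] -> gcdA A i%:Z n == 1 <->
    forall p, prime p -> p %| n -> ~~ (p %| d) -> ~~ (p ^ t p %| i).
  move=> cop_w eq_iw; split=> [/tP cop_i p p_pr dv_pn _|cop_i].
    exact: cop_i.
  apply/tP => // p p_pr dv_pn.
  have [dv_pd|] := boolP (p %| d); last exact: cop_i.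
  have := (tP d w Ad).1 cop_w p p_pr dv_pd.
  rewrite /dvdn -(modn_dvdm w (dv_ptd _ p_pr dv_pd)) -(eqP eq_iw).
  by rewrite modn_dvdm // dv_ptd.
(* The successor form gives ['I_m.+1] its addition modulo [m.+1], under which translations are
   injective. *)
case: n => [//|m] in n_gt0 Ad An dv_dn st tP dv_pt n' co_dn' dv_ptn' copE *.
(* Subtraction in [nat] truncates, so [d.-1 * u] stands for [- u] modulo [d]. *)
set c := chinese d n' (v + d.-1 * u) 0.
have c_d i : (i + c == v %[mod d]) = (i == u %[mod d]).
  rewrite -modnDmr /c chinese_modl // modnDmr.
  rewrite addnCA -{2}[v]addn0 eqn_modDl -(eqn_modDr (d.-1 * u) i).
  by rewrite -mulSn prednK // mod0n modnMr.
have c_n' : n' %| c by rewrite /dvdn /c chinese_modr // mod0n.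
rewrite [RHS](reindex_inj (addIr (inord (c %% m.+1) : 'I_m.+1)%R)) /=.
apply: eq_bigl => i; rewrite inordK ?ltn_mod // modnDmr gcdA_modn //.
rewrite modn_dvdm // c_d.
case: (boolP (i == u %[mod d])) => eq_iu; rewrite ?andbF ?andbT //.
have eq_icv : i + c == v %[mod d] by rewrite c_d.
apply/idP/idP => [/(copE _ _ cop_u eq_iu)|/(copE _ _ cop_v eq_icv)] cop_i.
  apply/(copE _ _ cop_v eq_icv) => p p_pr dv_pn ndv_pd.
  by rewrite dvdn_addl ?cop_i // (dvdn_trans _ c_n') // dv_ptn'.
apply/(copE _ _ cop_u eq_iu) => p p_pr dv_pn ndv_pd.
have := cop_i p p_pr dv_pn ndv_pd.
by rewrite dvdn_addl // (dvdn_trans _ c_n') // dv_ptn'.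
Qed.

(** Reduction modulo [d] sends residues prime to [n] to residues prime to [d], because [A d] is
    contained in [A n]; all its fibres have the size of the fibre over 1. *)
Lemma totientA_mul_count A n d : regular_system A -> 0 < n -> d \in A n ->
  totientA A n =
  (\sum_(j < n | (gcdA A j n == 1) && (j == 1 %[mod d])) 1) * totientA A d.
Proof.
move=> hA n_gt0 Ad; have d_gt0 := regular_system_gt0 hA n_gt0 Ad.
rewrite !totientA_ord // big_distrr /=.
have dP j : j %% d < d by rewrite ltn_mod.
rewrite (partition_big (fun j : 'I_n => Ordinal (dP j))
  (fun u : 'I_d => gcdA A u d == 1)) /=; last first.
  move=> j /gcdA_eq1P cop_j; rewrite gcdA_modn //; apply/gcdA_eq1P => // e.
  by rewrite (regular_system_sub _ hA n_gt0) // => /andP[Ae _]; apply: cop_j.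
apply: eq_bigr => u cop_u; rewrite muln1.
rewrite -(@sum_gcdA_eq1_mod A n d u 1) //; last first.
  by apply/gcdA_eq1P => // e _; rewrite dvdn1 => /eqP.
by apply: eq_bigl => j; rewrite -val_eqE /= (modn_small (ltn_ord u)).
Qed.

Local Open Scope ring_scope.

(** * Roots of unity and the factorization of ['X^n - 1] *)

Lemma zetaX (R : realType) n k : zeta R n ^+ k =
  Complex (cos (2 * pi / n%:R * k%:R)) (sin (2 * pi / n%:R * k%:R)).
Proof.
elim: k => [|k IHk]; first by rewrite mulr0 cos0 sin0.
rewrite exprSr IHk /zeta; set x : R := 2 * pi / n%:R.
rewrite -[x * k.+1%:R](_ : x * k%:R + x = _) ?cosD ?sinD; last first.
  by rewrite -natr1 mulrDr mulr1.
by apply/eqP; rewrite eq_complex /= eqxx addrC eqxx.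
Qed.

Lemma zetaX_divn (R : realType) n g k : (0 < n)%N -> (g %| n)%N ->
  zeta R n ^+ (g * k) = zeta R (n %/ g) ^+ k.
Proof.
move=> n_gt0 dv_gn; rewrite !zetaX.
suff -> : 2 * pi / n%:R * (g * k)%:R = 2 * pi / (n %/ g)%:R * k%:R :> R by [].
have g_gt0 := dvdn_gt0 n_gt0 dv_gn.
have ng_gt0 : (0 < n %/ g)%N by rewrite divn_gt0 // dvdn_leq.
rewrite -{1}(divnK dv_gn) !natrM.
by field; rewrite !pnatr_eq0 -!lt0n g_gt0 ng_gt0.
Qed.

(** If the power [k] of zeta were 1 with [0 < k < n], the half angle [y = pi * k / n] would satisfy
    [cos (2 * y) = 1], hence [sin y = 0], although [y] lies strictly between 0 and [pi]. *)
Lemma zeta_prim_root (R : realType) n : (0 < n)%N ->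
  n.-primitive_root (zeta R n).
Proof.
move=> n_gt0; have n_neq0 : n%:R != 0 :> R by rewrite pnatr_eq0 -lt0n.
apply/andP; split=> //; apply/forallP => i; apply/eqP.
rewrite unity_rootE; have [->|neq_in] := eqVneq i.+1 n.
  by rewrite zetaX divfK // mulr_natl cos2pi sin2pi eqxx.
have lt_in : (i.+1 < n)%N by rewrite ltn_neqAle neq_in ltn_ord.
apply/negP; rewrite zetaX eq_complex => /andP[/= /eqP cos1 _].
set y : R := pi / n%:R * i.+1%:R.
have y_gt0 : 0 < y by rewrite !mulr_gt0 ?pi_gt0 ?invr_gt0 ?ltr0n.
have y_ltpi : y < pi.
  rewrite /y mulrAC -mulrA gtr_pMr ?pi_gt0 // ltr_pdivrMr ?ltr0n //.
  by rewrite mul1r ltr_nat.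
have sin_y : 0 < sin y by rewrite sin_gt0_pi // y_gt0.
have := cos2Dsin2 y; have := cos_mulr2n y.
have -> : y *+ 2 = 2 * pi / n%:R * i.+1%:R by rewrite /y -mulr_natl; ring.
rewrite cos1; have := exprn_gt0 2 sin_y; lra.
Qed.

Lemma PhiA_ord (R : realType) A n : regular_system A -> (0 < n)%N ->
  PhiA R A n = \prod_(j < n | gcdA A j n == 1%N) ('X - (zeta R n ^+ j)%:P).
Proof.
move=> hA n_gt0; rewrite /PhiA.
rewrite (@big_nat1_periodic _ _ _ n (fun j => gcdA A j%:Z n == 1%N)) //.
  by rewrite -(gcdA_modn n) // modnn.
by rewrite (prim_expr_order (zeta_prim_root _ n_gt0)).
Qed.

(** Multiplication by [g] maps [A (n %/ g)] onto the multiples of [g] in [A n], so it carries the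
    common divisors of [j] and [n %/ g] to those of [g * j] and [n] that [g] divides. *)
Lemma gcdA_mull A n g j : regular_system A -> (0 < n)%N -> g \in A n ->
  (gcdA A (g * j)%N n == g) = (gcdA A j (n %/ g) == 1%N).
Proof.
move=> hA n_gt0 Ag; have g_gt0 := regular_system_gt0 hA n_gt0 Ag.
have dv_gn := regular_system_dvd hA n_gt0 Ag.
have ng_gt0 : (0 < n %/ g)%N by rewrite divn_gt0 // dvdn_leq.
have dv_gG : (g %| gcdA A (g * j)%N n)%N.
  by rewrite dvdn_gcdA // dvdzE /= dvdn_mulr.
apply/eqP/gcdA_eq1P => // [gcdg d Ad dv_dj|all1].
  apply/eqP; rewrite -dvdn1 -(dvdn_pmul2l g_gt0) muln1 -{2}gcdg.
  by rewrite dvdn_gcdA ?dvdzE /= ?dvdn_pmul2l // -regular_system_quo.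
have AG := gcdA_mem (g * j)%N hA n_gt0.
have dv_GG := dvdnn (gcdA A (g * j)%N n); rewrite dvdn_gcdA // in dv_GG.
have [d] := dvdnP dv_gG; rewrite [(d * g)%N]mulnC => defG.
rewrite defG (all1 d) ?muln1 //; first by rewrite regular_system_quo // -defG.
by move: dv_GG; rewrite defG dvdzE /= dvdn_pmul2l.
Qed.

Lemma prod_gcdA_eq (R : realType) A n g : regular_system A -> (0 < n)%N ->
  g \in A n ->
  \prod_(0 <= i < n | gcdA A i n == g) ('X - (zeta R n ^+ i)%:P) =
  PhiA R A (n %/ g).
Proof.
move=> hA n_gt0 Ag; have g_gt0 := regular_system_gt0 hA n_gt0 Ag.
have dv_gn := regular_system_dvd hA n_gt0 Ag.
have ng_gt0 : (0 < n %/ g)%N by rewrite divn_gt0 // dvdn_leq.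
rewrite PhiA_ord // -(big_mkord (fun j => gcdA A j%:Z (n %/ g) == 1%N)
  (fun j => 'X - (zeta R (n %/ g) ^+ j)%:P)).
under [RHS]eq_bigr => j _ do rewrite -zetaX_divn //.
(* Both sides become products over lists of indices, matched by [j] to [g * j]. *)
rewrite -big_filter -[RHS]big_filter.
rewrite -(big_map (muln g) xpredT (fun i => 'X - (zeta R n ^+ i)%:P)).
apply: perm_big; apply: uniq_perm.
- by rewrite filter_uniq // iota_uniq.
- rewrite map_inj_uniq ?filter_uniq ?iota_uniq //.
  by move=> i j /eqP; rewrite eqn_pmul2l // => /eqP.
move=> i; rewrite mem_filter mem_index_iota /=.
apply/andP/mapP => [[/eqP gcdg lt_in]|[j]].
  have : (g%:Z %| i%:Z)%Z by rewrite -(dvdn_gcdA _ hA n_gt0) ?gcdg.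
  rewrite dvdzE /= => /dvdnP[j defi].
  exists j; last by rewrite mulnC.
  rewrite mem_filter mem_index_iota /= -gcdA_mull // mulnC -defi gcdg eqxx /=.
  by rewrite ltn_divRL // -defi.
rewrite mem_filter mem_index_iota /= -gcdA_mull // => /andP[cop_j lt_j] ->.
by split=> //; rewrite mulnC -ltn_divRL.
Qed.

Lemma Xn_sub1_PhiA (R : realType) A n : regular_system A -> (0 < n)%N ->
  'X^n - 1 = \prod_(d <- A n) PhiA R A d.
Proof.
move=> hA n_gt0; rewrite -(factor_Xn_sub_1 (zeta_prim_root R n_gt0)).
(* The inner product has the single factor [g = gcdA A i n]; exchanging the products groups the
   roots by [g]. *)
transitivity (\prod_(0 <= i < n) \prod_(g <- A n | gcdA A i n == g)
    ('X - (zeta R n ^+ i)%:P)).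
  apply: eq_bigr => i _; under eq_bigl => g do rewrite eq_sym.
  by rewrite (@fbig_pred1_inj _ _ _ _ _ _ id) // gcdA_mem.
rewrite (exchange_big_dep xpredT) //= big_seq.
under eq_bigr => g Ag do rewrite prod_gcdA_eq //.
(* The class of [g] contributes index [n %/ g], and [g] to [n %/ g] is an involution of [A n]. *)
rewrite -big_seq -(big_map (divn n) xpredT (PhiA R A)).
have quoA g : g \in A n -> (n %/ g)%N \in A n by apply: regular_system_divn.
have quoK g : g \in A n -> (n %/ (n %/ g))%N = g.
  move=> Ag; have dv_gn := regular_system_dvd hA n_gt0 Ag.
  by rewrite -{1}(divnK dv_gn) mulKn ?(regular_system_gt0 hA n_gt0 (quoA g Ag)).
apply: perm_big; apply: uniq_perm.
- rewrite map_inj_in_uniq ?fset_uniq // => g h Ag Ah eq_gh.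
  by rewrite -(quoK g) // eq_gh quoK.
- exact: fset_uniq.
move=> d; apply/mapP/idP => [[g Ag ->]|Ad]; first exact: quoA.
by exists (n %/ d)%N; rewrite ?quoA ?quoK.
Qed.

(** The first conjunct ensures that the truncating division in the exponents is exact. *)
Theorem theorem6 (R : realType) (A : nat -> {fset nat}) (n : nat)
    (hA : regular_system A) (hn : (0 < n)%N) :
  (forall d : nat, d \in A n -> (totientA A d %| totientA A n)%N) /\
  \prod_(1 <= j < n.+1 | gcdA A j%:Z n == 1%N)
     ('X^(gcdA A (j%:Z - 1) n) - 1) =
  \prod_(d <- A n) PhiA R A d ^+ (totientA A n %/ totientA A d)%N
  :> {poly R[i]}.
Proof.
split=> [d Ad|]; first by rewrite (totientA_mul_count hA hn Ad) dvdn_mull.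
(* With [g = gcdA A (j - 1) n], the members of [A g] are exactly the members of [A n] dividing
   [j - 1]. *)
transitivity (\prod_(1 <= j < n.+1 | gcdA A j%:Z n == 1%N)
  \prod_(d <- A n | (d%:Z %| j%:Z - 1)%Z) PhiA R A d).
  apply: eq_bigr => j _; have Ag := gcdA_mem (j%:Z - 1) hA hn.
  rewrite (Xn_sub1_PhiA _ hA) ?(regular_system_gt0 hA hn) // -[RHS]big_filter.
  apply: perm_big; apply: uniq_perm; rewrite ?filter_uniq ?fset_uniq // => d.
  rewrite mem_filter (regular_system_sub _ hA hn) // andbC.
  by apply: andb_id2r => Ad; rewrite dvdn_gcdA.
rewrite (exchange_big_dep xpredT) //= big_seq [RHS]big_seq.
apply: eq_bigr => d Ad; under eq_bigr => j _ do rewrite -[PhiA R A d]expr1.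
have d_gt0 := regular_system_gt0 hA hn Ad.
rewrite prodrXr (totientA_mul_count hA hn Ad) mulnK ?totientA_gt0 //.
congr (_ ^+ _).
under eq_bigl => j do rewrite -eqz_mod_dvd !modz_nat eqz_nat.
(* The count over [1..n] equals that over [0..n-1]: since [d] divides [n], the indices [n] and 0
   satisfy the same conditions. *)
rewrite (@big_nat1_periodic _ _ _ n
  (fun j => (gcdA A j%:Z n == 1%N) && (j == 1 %[mod d])%N)) //.
rewrite -(gcdA_modn n) // modnn mod0n; congr (_ && (_ == _)).
exact/eqP/(regular_system_dvd hA hn).
Qed.
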